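(* Let $d$ be a positive odd integer divisible by $3$, let $r$ be a positive odd integer, let $a$ be an integer with $a\equiv 1\pmod{12}$, and let $b=2^d a-3^r$. Then the equation $$ax^d-y^2-z^2+xyz-b=0$$ has no solution $(x,y,z)\in\mathbb{Z}^3$ with $x\equiv 1\pmod{12}$ or $x\equiv 9\pmod{12}$. *)

(* Defs.v *)
From mathcomp Require Export all_boot all_order all_algebra.

(* Main.v *)
(** The equation says y^2 - x y z + z^2 = a (x^d - 2^d) + 3^r.
    If x = 1 mod 12, then modulo 3 it reads (y + z)^2 = 2, which is absurd.
    If x = 9 mod 12, then modulo m = x - 2 = 7 mod 12 it reads (y - z)^2 = 3^r, so 3 is a
    square modulo m.  This is ruled out by descent: choosing an even
    root v of v^2 = 3 with |v| < |m|, the cofactor of m in v^2 - 3 (divided by 3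
    when 3 divides v) is again 5 or 7 modulo 12, and is smaller than m. *)
Require Import Defs.
From mathcomp Require Import all_boot all_order all_algebra.
From mathcomp Require Import zify ring.
Import GRing.Theory Num.Theory.
Local Open Scope ring_scope.

Lemma dvdz_subrXX (x y : int) (n : nat) : (x - y %| x ^+ n - y ^+ n)%Z.
Proof. by rewrite subrXX dvdz_mulr. Qed.

Lemma sqr_mod3 (w : int) : (w %% 3)%Z = 0 \/ (w ^+ 2 %% 3)%Z = 1.
Proof.
rewrite expr2 -modzMm.
have [->|[->|->]] : (w %% 3)%Z = 0 \/ (w %% 3)%Z = 1 \/ (w %% 3)%Z = 2 by lia.
- by left.
- by right.
- by right.
Qed.

(** With [s = v %% m], both [s] and [|m| - s] are roots modulo [m]; as [m] is odd, one of them is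
    even. *)
Lemma small_even_sqrt (m v c : int) :
  (m %% 2)%Z = 1 -> (m %| v ^+ 2 - c)%Z ->
  exists2 w : int, 0 <= 2 * w < `|m| & (m %| (2 * w) ^+ 2 - c)%Z.
Proof.
move=> modd /dvdzP[k hk].
have hv := divz_eq v m; set q := (v %/ m)%Z in hv; set s := (v %% m)%Z in hv.
have m0 : m != 0 by apply/eqP=> m0; rewrite m0 in modd.
have s0 : 0 <= s by rewrite modz_ge0.
have sm : s < `|m| by rewrite ltz_mod.
have [e|e] : (s %% 2)%Z = 0 \/ (s %% 2)%Z = 1 by lia.
  exists (s %/ 2)%Z; first by lia.
  have -> : 2 * (s %/ 2)%Z = s by lia.
  apply/dvdzP; exists (k - q * (v + s)).
  have -> : s = v - q * m by rewrite hv; ring.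
  have -> : c = v ^+ 2 - k * m by rewrite -hk; ring.
  ring.
exists ((`|m| - s) %/ 2)%Z; first by lia.
have -> : 2 * ((`|m| - s) %/ 2)%Z = `|m| - s by lia.
have -> : (`|m| - s) ^+ 2 - c = v ^+ 2 - c + `|m| ^+ 2 - 2 * `|m| * s - (v + s) * (q * m).
  rewrite hv; ring.
rewrite hk; apply/dvdzP.
have [->|->] : `|m| = m \/ `|m| = - m by lia.
  by exists (k + m - 2 * s - (v + s) * q); ring.
by exists (k + m + 2 * s - (v + s) * q); ring.
Qed.

(** Each unit modulo 12 is its own inverse, so a product congruent to 1 or -1 makes [k] congruent to
    [m] or [-m]; the classes 5 and 7 are opposite. *)
Lemma cofactor_mod12 (m k : int) :
  (m %% 12)%Z = 5 \/ (m %% 12)%Z = 7 ->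
  (k * m %% 12)%Z = 1 \/ (k * m %% 12)%Z = 11 ->
  (k %% 12)%Z = 5 \/ (k %% 12)%Z = 7.
Proof.
move=> hm; rewrite {1 2}(divz_eq m 12) mulrDr mulrA.
set t := k * _; case: hm => ->; lia.
Qed.

(** It suffices that [|v ^+ 2 - 3| < |m| ^+ 2]; the bound [2 <= |m|] covers [v = 0]. *)
Lemma cofactor_lt (m v k : int) :
  0 <= v < `|m| -> 2 <= `|m| -> v ^+ 2 - 3 = k * m -> `|k| < `|m|.
Proof.
move=> hv hm hk; rewrite -(ltr_pM2r (x := `|m|)); last by lia.
rewrite -normrM -hk; nia.
Qed.

Lemma three_nonresidue (m v : int) :
  (m %% 12)%Z = 5 \/ (m %% 12)%Z = 7 -> ~~ (m %| v ^+ 2 - 3)%Z.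
Proof.
(* The induction is on the absolute value because cofactors may be negative. *)
elim/ltn_ind: {m}`|m|%N {-2}m (erefl `|m|%N) v => n IH m mn v hm.
apply/negP => hdvd; have modd : (m %% 2)%Z = 1 by lia.
have [w hw /dvdzP[k hk]] := small_even_sqrt _ _ _ modd hdvd.
have small : (`|k| < n)%N.
  by have := cofactor_lt _ _ _ hw _ hk; lia.
have [w3|w3] := sqr_mod3 w.
- have hw3 : w = 3 * (w %/ 3)%Z by clear -w3; lia.
  set u := (w %/ 3)%Z in hw3.
  (* 3 divides [k * m = (2 * w) ^+ 2 - 3], while [m] is prime to 3. *)
  have [k' kk'] : exists k', k = 3 * k'.
    exists (k %/ 3)%Z; move: hk; rewrite {1}(divz_eq m 12) mulrDr mulrA hw3.
    by set t := k * _; clear -hm; case: hm => ->; lia.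
  have hk' : 12 * u ^+ 2 - 1 = k' * m.
    by apply: (@mulfI _ 3) => //; rewrite [RHS]mulrA -kk' -hk hw3; ring.
  have small' : (`|k'| < n)%N by clear -kk' small; lia.
  apply: (negP (IH _ small' k' erefl (2 * w) _)).
    (* Here [k' * m = 12 * u ^+ 2 - 1] is 11 modulo 12. *)
    by apply: (cofactor_mod12 _ _ hm); rewrite -hk'; clear; lia.
  by rewrite hk kk'; apply/dvdzP; exists (3 * m); ring.
- apply: (negP (IH _ small k erefl (2 * w) _)).
    (* Since [w ^+ 2] is 1 modulo 3, [4 * w ^+ 2 - 3] is 1 modulo 12. *)
    by apply: (cofactor_mod12 _ _ hm); rewrite -hk; clear -w3; lia.
  by rewrite hk; apply/dvdzP; exists m; ring.
Qed.

(** Write [r = 2q + 1] and let [c] invert 3 modulo [m]: a root [u] of [3 ^+ r] would give the root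
    [u * c ^+ q] of 3. *)
Lemma odd_pow3_nonresidue (m u : int) (r : nat) :
  (m %% 12)%Z = 5 \/ (m %% 12)%Z = 7 -> odd r -> ~~ (m %| u ^+ 2 - 3 ^+ r)%Z.
Proof.
move=> hm hr; apply/negP => hu.
have [c hc] : exists c : int, (m %| 3 * c - 1)%Z.
  have [e|e] : (m %% 3)%Z = 1 \/ (m %% 3)%Z = 2 by lia.
    exists (- (m %/ 3)%Z); apply/dvdzP; exists (-1); lia.
  exists ((m + 1) %/ 3)%Z; apply/dvdzP; exists 1; lia.
have rq : r = (r./2.*2.+1)%N by rewrite -[LHS]odd_double_half hr.
set q := r./2 in rq; have /negP[] := three_nonresidue m (u * c ^+ q) hm.
have -> : (u * c ^+ q) ^+ 2 - 3 =
    c ^+ q ^+ 2 * (u ^+ 2 - 3 ^+ r) + 3 * ((3 * c) ^+ q.*2 - 1 ^+ q.*2).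
  rewrite rq expr1n (exprS 3) !exprMn -muln2 !exprM; ring.
by rewrite rpredD // dvdz_mull // (dvdz_trans hc) // dvdz_subrXX.
Qed.

Theorem corollary2p2 (d r : nat) (a b : int)
    (hd0 : (0 < d)%N) (hd : odd d) (hd3 : (3 %| d)%N)
    (hr0 : (0 < r)%N) (hr : odd r)
    (ha : (a = 1 %[mod 12])%Z)
    (hb : b = 2 ^+ d * a - 3 ^+ r) :
  ~ exists x y z : int,
      ((x = 1 %[mod 12])%Z \/ (x = 9 %[mod 12])%Z) /\
      a * x ^+ d - y ^+ 2 - z ^+ 2 + x * y * z - b = 0.
Proof.
case=> x [y [z [hx heq]]].
have {heq hb} key : y ^+ 2 + z ^+ 2 - x * y * z = a * (x ^+ d - 2 ^+ d) + 3 ^+ r.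
  by apply/eqP; rewrite -subr_eq0 -oppr_eq0 -[X in _ == X]heq hb; apply/eqP; ring.
case: hx => hx.
  have mod3 (t : int) : (t = 1 %[mod 12])%Z -> (3 %| t - 1)%Z.
    by move/eqP; rewrite eqz_mod_dvd; apply: dvdz_trans.
  have h1 : (3 %| x ^+ d - 1)%Z.
    by rewrite -[X in _ - X](expr1n _ d); apply: dvdz_trans (mod3 x hx) (dvdz_subrXX _ _ _).
  have h2 : (3 %| 2 ^+ d + 1)%Z.
    (* [2 - (-1) = 3] divides [2 ^+ d - (-1) ^+ d], and [d] is odd. *)
    by have := dvdz_subrXX 2 (-1) d; rewrite -signr_odd hd expr1 opprK.
  have h3 : (3 %| 3 ^+ r)%Z by rewrite dvdz_exp.
  have h4 : (3 %| (y + z) ^+ 2 - 2)%Z.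
    (* Every summand on the right is divisible by 3. *)
    have -> : (y + z) ^+ 2 - 2 = a * (x ^+ d - 1) - a * (2 ^+ d + 1) + 3 ^+ r
        + 2 * (a - 1) + (x + 2) * (y * z).
      by apply/eqP; rewrite -subr_eq0; apply/eqP; move: key; lia.
    rewrite !rpredD ?rpredN ?(dvdz_mull _ h1) ?(dvdz_mull _ h2) //=.
      by rewrite dvdz_mull // mod3.
    by rewrite dvdz_mulr //; have := mod3 x hx; clear; lia.
  have [hs|hs] := sqr_mod3 (y + z).
    by move: h4; rewrite expr2; clear -hs; lia.
  by clear -h4 hs; lia.
have hm : ((x - 2) %% 12)%Z = 5 \/ ((x - 2) %% 12)%Z = 7 by lia.
have /negP[] := odd_pow3_nonresidue (x - 2) (y - z) r hm hr.
(* Modulo [x - 2], [x ^+ d] becomes [2 ^+ d] and [x * y * z] becomes [2 * y * z], completing the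
   square. *)
have -> : (y - z) ^+ 2 - 3 ^+ r = a * (x ^+ d - 2 ^+ d) + y * z * (x - 2).
  by rewrite -[a * _](addrK (3 ^+ r)) -key; ring.
by rewrite rpredD ?dvdz_mull // dvdz_subrXX.
Qed.
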